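(* Let $(X,\tau)$ be a topological space. Then the following statements are equivalent: (a) $(X,\tau)$ is a semi-$T_{\frac{1}{2}}$-space; (b) every $g.V_s$-set of $(X,\tau)$ is a $V_s$-set of $(X,\tau)$.
   Context: Let $(X,\tau)$ be a topological space. A subset $A\subseteq X$ is semi-open if there is $O\in\tau$ with $O\subseteq A\subseteq \mathrm{Cl}(O)$; a subset is semi-closed if its complement is semi-open. $SO(X,\tau)$ denotes the family of all semi-open sets. The semi-closure $\mathrm{sCl}(A)$ is the intersection of all semi-closed sets containing $A$. For $B\subseteq X$, $B^c=X\setminus B$, $B^{\Lambda_s}=\bigcap\{O : O\supseteq B,\ O\in SO(X,\tau)\}$ and $B^{V_s}=\bigcup\{F : F\subseteq B,\ F^c\in SO(X,\tau)\}$. A subset $B$ is a $V_s$-set if $B=B^{V_s}$. A subset $B$ is a $g.\Lambda_s$-set if $B^{\Lambda_s}\subseteq F$ whenever $B\subseteq F$ and $F$ is semi-closed; $B$ is a $g.V_s$-set if $B^c$ is a $g.\Lambda_s$-set. A subset $B$ is $sg$-closed (semi-generalized closed) if $\mathrm{sCl}(B)\subseteq O$ whenever $B\subseteq O$ and $O\in SO(X,\tau)$. The space $(X,\tau)$ is a semi-$T_{\frac{1}{2}}$-space if every $sg$-closed set in $(X,\tau)$ is semi-closed in $(X,\tau)$. *)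

(* Defs.v *)
From mathcomp Require Import all_boot all_order.
From mathcomp Require Import classical_sets topology.

Set Implicit Arguments.
Unset Strict Implicit.
Unset Printing Implicit Defensive.

Local Open Scope classical_set_scope.

Definition semi_open (X : topologicalType) (A : set X) : Prop :=
  exists O : set X, [/\ open O, O `<=` A & A `<=` closure O].

Definition semi_closed (X : topologicalType) (A : set X) : Prop :=
  semi_open (~` A).

Definition sCl (X : topologicalType) (A : set X) : set X :=
  \bigcap_(F in [set F | semi_closed F /\ A `<=` F]) F.

Definition Lambda_s (X : topologicalType) (B : set X) : set X :=
  \bigcap_(O in [set O | B `<=` O /\ semi_open O]) O.

Definition V_s (X : topologicalType) (B : set X) : set X :=
  \bigcup_(F in [set F | F `<=` B /\ semi_open (~` F)]) F.

Definition V_s_set (X : topologicalType) (B : set X) : Prop := B = V_s B.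

Definition g_Lambda_s_set (X : topologicalType) (B : set X) : Prop :=
  forall F : set X, B `<=` F -> semi_closed F -> Lambda_s B `<=` F.

Definition g_V_s_set (X : topologicalType) (B : set X) : Prop :=
  g_Lambda_s_set (~` B).

Definition sg_closed (X : topologicalType) (B : set X) : Prop :=
  forall O : set X, B `<=` O -> semi_open O -> sCl B `<=` O.

Definition semi_T_half (X : topologicalType) : Prop :=
  forall B : set X, sg_closed B -> semi_closed B.

(* Main.v *)
(** Both conditions are equivalent to: every singleton is semi-open or
    semi-closed.  If [{x}] is not semi-closed, the only semi-open superset of its
    complement is the whole space, so the complement is [sg]-closed;
    dually, if [{x}] is not semi-open, then [{x}] is a [g.V_s]-set.  Conversely, if [x]
    lies outside [B] and [{x}] is semi-open or semi-closed, then the complement of [{x}]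
    is a semi-closed or semi-open superset of [B], which separates [x] from
    the relevant hull of [B]. *)

Require Import Defs.
From mathcomp Require Import all_boot all_order.
From mathcomp Require Import boolp classical_sets topology.

Local Open Scope classical_set_scope.

Lemma semi_open_bigcup (X : topologicalType) (I : Type) (D : set I)
    (A : I -> set X) :
  (forall i, D i -> semi_open (A i)) -> semi_open (\bigcup_(i in D) A i).
Proof.
(* Taking every open set inside some [A i] avoids choosing one witness per index. *)
move=> sA; exists (\bigcup_(O in [set O | open O /\ exists2 i, D i & O `<=` A i]) O).
split.
- by apply: bigcup_open => O [].
- by move=> x [O [_ [i Di OA]] Ox]; exists i => //; exact: OA.
- move=> x [i Di Aix]; have [O [oO OA AO]] := sA i Di.
  apply: closureS (AO _ Aix) => y Oy.
  by exists O => //; split => //; exists i.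
Qed.

Lemma semi_closed_sCl (X : topologicalType) (B : set X) : semi_closed (sCl B).
Proof. by rewrite /semi_closed setC_bigcap; apply: semi_open_bigcup => F []. Qed.

Lemma subset_setC1_full {T : Type} {x : T} {A : set T} :
  ~` [set x] `<=` A -> A <> ~` [set x] -> A = setT.
Proof.
move=> xA neq; apply/seteqP; split=> // y _.
have [->|/xA //] := pselect (y = x).
apply: contrapT => nAx; apply: neq; apply/seteqP; split=> // z Az zx.
by rewrite zx in Az.
Qed.

Lemma semi_T_half_set1 (X : topologicalType) (x : X) :
  semi_T_half X -> semi_open [set x] \/ semi_closed [set x].
Proof.
move=> T_half; have [|nc] := pselect (semi_closed [set x]); first by right.
left; rewrite -[[set x]]setCK; apply: T_half => O xO sO.
rewrite (subset_setC1_full xO) // => Oe.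
by apply: nc; rewrite /semi_closed -Oe.
Qed.

Lemma g_V_s_V_s_set1 (X : topologicalType) (x : X) :
  (forall B : set X, g_V_s_set B -> V_s_set B) ->
  semi_open [set x] \/ semi_closed [set x].
Proof.
move=> gV; have [|no] := pselect (semi_open [set x]); first by left.
right; have VE : V_s_set [set x].
  apply: gV => F xF cF; rewrite (subset_setC1_full xF) // => Fe.
  by apply: no; rewrite -[[set x]]setCK -Fe.
(* A semi-closed subset of [[set x]] that contains [x] can only be [[set x]] itself. *)
have [F [Fx cF] xF] : V_s [set x] x by rewrite /V_s_set in VE; rewrite -VE.
suff -> : [set x] = F by [].
by apply/seteqP; split => // y ->.
Qed.

Lemma set1_semi_T_half (X : topologicalType) :
  (forall x : X, semi_open [set x] \/ semi_closed [set x]) -> semi_T_half X.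
Proof.
move=> set1P B sgB; suff -> : B = sCl B by exact: semi_closed_sCl.
apply/seteqP; split=> [x Bx F [_ BF]|x clx]; first exact: BF.
apply: contrapT => nBx; have Bx : B `<=` [set~ x] by rewrite subsetC1 inE.
have [ox|cx] := set1P x.
  by apply: (clx (~` [set x])) => //; split=> //; rewrite /semi_closed setCK.
(* By unfolding, [cx] says that the complement of [[set x]] is semi-open, so [sgB] would put [x] in
   that complement. *)
exact: (sgB _ Bx cx x clx erefl).
Qed.

Lemma set1_g_V_s_V_s (X : topologicalType) (B : set X) :
  (forall x : X, semi_open [set x] \/ semi_closed [set x]) ->
  g_V_s_set B -> V_s_set B.
Proof.
move=> set1P gB; apply/seteqP; split=> [x Bx|x [F [FB _] /FB] //].
have [ox|cx] := set1P x; last by exists [set x] => //; split=> // y ->.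
apply: contrapT => nVx; apply: (gB (~` [set x])) (erefl x).
- by rewrite setCS => y ->.
- by rewrite /semi_closed setCK.
move=> O [BO sO]; apply: contrapT => nOx; apply: nVx; exists (~` O) => //.
by split; [exact: subsetCl | rewrite setCK].
Qed.

Theorem theorem5p1 (X : topologicalType) :
  semi_T_half X <-> (forall B : set X, g_V_s_set B -> V_s_set B).
Proof.
split=> [T_half B|gV].
  by apply: set1_g_V_s_V_s => x; exact: semi_T_half_set1.
by apply: set1_semi_T_half => x; exact: g_V_s_V_s_set1.
Qed.
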